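(* The ceiling function $x\mapsto\lceil x\rceil$ is the only function $f:\mathbb{R}\rightarrow\mathbb{R}$ satisfying the decomposer equation $$f(f^*(x)+f(y))=f(y)\quad\text{for all }x,y\in\mathbb{R}$$ together with the conditions: (i) $f^*(\mathbb{R})=(-1,0]$; (ii) $f(\mathbb{R})\cap\mathbb{Z}\neq\emptyset$. Moreover, the functions $f:\mathbb{R}\to\mathbb{R}$ satisfying the decomposer equation and condition (i) are exactly the functions of the form $f(x)=\lceil x-c\rceil+c$, where $c$ is an arbitrary real constant.
   Context: For $f:\mathbb{R}\to\mathbb{R}$, the function $f^*:\mathbb{R}\to\mathbb{R}$ is defined by $f^*(x)=x-f(x)$. $\lceil x\rceil$ denotes the least integer greater than or equal to the real number $x$, regarded as a function $\mathbb{R}\to\mathbb{R}$. $f(\mathbb{R})$ and $f^*(\mathbb{R})$ denote the ranges of $f$ and $f^*$. *)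

(* Defs.v *)
From mathcomp Require Export all_boot all_order all_algebra.
From mathcomp Require Export boolp classical_sets functions set_interval reals.

Set Implicit Arguments.
Unset Strict Implicit.
Unset Printing Implicit Defensive.

Import Order.TTheory GRing.Theory Num.Theory.

Local Open Scope ring_scope.

Definition fstar (R : realType) (f : R -> R) : R -> R := fun x => x - f x.

Definition decomposer (R : realType) (f : R -> R) : Prop :=
  forall x y : R, f (fstar f x + f y) = f y.

(* Main.v *)
(* If a = f y, the decomposer equation together with range f^* = (-1, 0] says
   that f is constantly a on (a - 1, a], and every x lies in (f x - 1, f x].
   So the intervals (a - 1, a], for a in the range of f, tile the line; hence
   the range is stable under a |-> a - 1 and a |-> a + 1, and it equals c + Z
   for c = f 0. *)
Require Import Defs.
From mathcomp Require Import all_boot all_order all_algebra.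
From mathcomp Require Import boolp classical_sets functions set_interval reals.
From mathcomp Require Import lra.

Import Order.TTheory GRing.Theory Num.Theory.

Local Open Scope classical_set_scope.
Local Open Scope ring_scope.

Lemma fstar_itv {R : realType} {f : R -> R} :
  range (fstar f) = `]-1, 0]%classic -> forall x, f x - 1 < x <= f x.
Proof.
move=> rf x; have : range (fstar f) (fstar f x) by exists x.
by rewrite rf /= in_itv /= /fstar => /andP[? ?]; apply/andP; split; lra.
Qed.

(** The offset [x - f y] lies in (-1, 0], hence equals [fstar f z] for some [z]; the equation at [z]
    and [y] then reads [f x = f y]. *)
Lemma decomposer_tile {R : realType} {f : R -> R} :
  decomposer f -> range (fstar f) = `]-1, 0]%classic ->
  forall x y, f y - 1 < x <= f y -> f x = f y.
Proof.
move=> df rf x y /andP[lt_x le_x].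
have : range (fstar f) (x - f y).
  by rewrite rf /= in_itv /=; apply/andP; split; lra.
by case=> z _ fz; have := df z y; rewrite fz subrK.
Qed.

(** Put [b = f (f x - 1)], so that [f x - 1 <= b < f x]. Were the first inequality strict, [b] would
    lie in the tiles ending at [b] and at [f x], forcing [b = f x]. *)
Lemma decomposer_range_pred {R : realType} {f : R -> R} :
  decomposer f -> range (fstar f) = `]-1, 0]%classic ->
  forall x, f (f x - 1) = f x - 1.
Proof.
move=> df rf x; have /andP[lt_b le_b] := fstar_itv rf (f x - 1).
have [lt_a|le_a] := ltP (f x - 1) (f (f x - 1)); last by lra.
have fb : f (f (f x - 1)) = f (f x - 1).
  by apply: decomposer_tile => //; apply/andP; split; lra.
have : f (f (f x - 1)) = f x.
  by apply: decomposer_tile => //; apply/andP; split; lra.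
lra.
Qed.

Lemma decomposer_range_succ {R : realType} {f : R -> R} :
  decomposer f -> range (fstar f) = `]-1, 0]%classic ->
  forall x, f (f x + 1) = f x + 1.
Proof.
move=> df rf x; have /andP[lt_b le_b] := fstar_itv rf (f x + 1).
have fb := decomposer_range_pred df rf (f x + 1).
have fa : f (f x) = f x.
  by apply: decomposer_tile => //; apply/andP; split; lra.
(* With [b = f (f x + 1)], the point [f x] lies in the tile ending at the value [b - 1], so
   [f x = b - 1]. *)
have : f (f x) = f (f (f x + 1) - 1).
  by apply: decomposer_tile => //; rewrite fb; apply/andP; split; lra.
lra.
Qed.

Lemma decomposer_range_addz {R : realType} {f : R -> R} :
  decomposer f -> range (fstar f) = `]-1, 0]%classic ->
  forall x (m : int), f (f x + m%:~R) = f x + m%:~R.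
Proof.
move=> df rf x; elim=> [|n IHn|n IHn].
- by rewrite addr0; apply: decomposer_tile => //; apply/andP; split; lra.
(* The induction hypothesis, read backwards, presents the shifted point as a value of [f], so a
   further unit shift applies. *)
- rewrite intS [1 + _]addrC rmorphD /= addrA -IHn.
  exact: decomposer_range_succ.
- rewrite intS opprD [- 1 - _]addrC rmorphB /= addrA -IHn.
  exact: decomposer_range_pred.
Qed.

(** The right-hand side is an integer translate of [f 0], hence a value of [f], and [x] lies in the
    tile that ends there. *)
Lemma decomposer_shifted_ceil {R : realType} {f : R -> R} :
  decomposer f -> range (fstar f) = `]-1, 0]%classic ->
  forall x, f x = Rceil (x - f 0) + f 0.
Proof.
move=> df rf x; rewrite RceilE.
have /andP[lt_x le_x] := ceil_itv (x - f 0).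
have fc := decomposer_range_addz df rf 0 (Num.ceil (x - f 0)).
rewrite addrC -fc; apply: decomposer_tile => //; rewrite fc.
by move: lt_x; rewrite rmorphB /= => lt_x; apply/andP; split; lra.
Qed.

Lemma shifted_ceil_decomposer {R : realType} (c : R) :
  decomposer (fun x : R => Rceil (x - c) + c).
Proof.
move=> x y; rewrite /fstar !RceilE; congr (_%:~R + _).
(* Once [c] cancels, the argument is an integer plus an offset in (-1, 0], so its ceiling is that
   integer. *)
apply: ceil_def; rewrite rmorphB /=.
have /andP[] := ceil_itv (x - c); rewrite rmorphB /= => lt_x le_x.
by apply/andP; split; lra.
Qed.

Lemma range_fstar_shifted_ceil {R : realType} (c : R) :
  range (fstar (fun x : R => Rceil (x - c) + c)) = `]-1, 0]%classic.
Proof.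
apply/seteqP; split=> [_ [x _ <-]|r] /=; rewrite in_itv /= /fstar.
  rewrite RceilE; have /andP[] := ceil_itv (x - c); rewrite rmorphB /=.
  by move=> lt_x le_x; apply/andP; split; lra.
(* At [r + c] the ceiling term is that of [r], which is 0, so [fstar] returns [r]. *)
move=> /andP[lt_r le_r]; exists (r + c) => //.
rewrite addrK RceilE (_ : Num.ceil r = 0) ?add0r ?addrK //.
by apply: ceil_def; rewrite rmorphB /=; apply/andP; split; lra.
Qed.

Lemma shifted_ceil_int {R : realType} (c x : R) :
  c \is a Num.int -> Rceil (x - c) + c = Rceil x.
Proof.
move=> c_int; rewrite !RceilE ceilDrz ?rpredN // ceilN //.
by rewrite rmorphB /= (ceilK c_int) subrK.
Qed.

Theorem corollary2p4 (R : realType) :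
  (forall f : R -> R,
     [/\ decomposer f,
         range (fstar f) = `]-1, 0]%classic
       & range f `&` [set z : R | z \is a Num.int] !=set0]
     <-> f = (fun x : R => Rceil x)) /\
  (forall f : R -> R,
     (decomposer f /\ range (fstar f) = `]-1, 0]%classic)
     <-> exists c : R, f = (fun x : R => Rceil (x - c) + c)).
Proof.
split=> f; split.
- move=> [df rf [_ [[x _ <-] /= fx_int]]].
  (* The integer value [f x] differs from [f 0] by a ceiling. *)
  have f0_int : f 0 \is a Num.int.
    move: fx_int; rewrite (decomposer_shifted_ceil df rf x) RceilE.
    by rewrite rpredDl ?rpred_int.
  apply/funext => y.
  by rewrite (decomposer_shifted_ceil df rf) shifted_ceil_int.
- have -> : (fun x : R => Rceil x) = (fun x => Rceil (x - 0) + 0).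
    by apply/funext => x; rewrite subr0 addr0.
  move=> ->; split.
  + exact: shifted_ceil_decomposer.
  + exact: range_fstar_shifted_ceil.
  + exists 0; split; last exact: rpred0.
    by exists 0 => //; rewrite subr0 addr0 Rceil0.
- move=> [df rf]; exists (f 0); apply/funext => x.
  exact: decomposer_shifted_ceil.
- move=> [c ->]; split; first exact: shifted_ceil_decomposer.
  exact: range_fstar_shifted_ceil.
Qed.
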